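(* Let $m\geq 2$ be an integer, let $q$ be a prime power with $q\geq 5$, let $s$ be an integer with $1\leq s\leq q-4$, and let $f\in R_q((m-1)(q-1)+s,m)$ satisfy $|f|=q-s+1$. Then the support of $f$ is contained in an affine line of $\mathbb{F}_q^m$.
   Context: $\mathbb{F}_q$ is the finite field with $q$ elements and $B_m^q$ is the $\mathbb{F}_q$-algebra of all functions $\mathbb{F}_q^m\to\mathbb{F}_q$. Every $f\in B_m^q$ is given by a unique polynomial in $\mathbb{F}_q[X_1,\ldots,X_m]$ of degree at most $q-1$ in each variable (its reduced form), and $\deg(f)$ is the total degree of this reduced form. For $0\leq r\leq m(q-1)$, the generalized Reed–Muller code is $R_q(r,m)=\{f\in B_m^q:\deg(f)\leq r\}$. The support of $f$ is $\{x\in\mathbb{F}_q^m: f(x)\neq 0\}$ and $|f|$ denotes its cardinality (the Hamming weight of $f$). *)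

(* Defs.v *)
From HB Require Import structures.
From mathcomp Require Import all_boot all_order all_algebra all_field.
From mathcomp Require Import mpoly.

Set Implicit Arguments.
Unset Strict Implicit.
Unset Printing Implicit Defensive.

Import GRing.Theory.
Local Open Scope ring_scope.

(* B_m^q, for q = #|F|. *)
Notation rm_fun F m := {ffun 'rV[F]_m -> F}.

Section Reduced.
Variables (F : finFieldType) (m : nat).
Implicit Types (p : {mpoly F[m]}) (f : rm_fun F m).

(* Every exponent is at most q - 1. *)
Definition reduced p := all (fun k : 'X_{1..m} => [forall i, k i < #|F|]%N) (msupp p).

Definition represents p f := [forall x : 'rV[F]_m, p.@[fun i => x 0 i] == f x].

Definition is_reduced_form f p := reduced p && represents p f.

Let bnd (d : 'I_m -> nat) p := forall k, k \in msupp p -> forall i, (k i <= d i)%N.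

Let bndD d p1 p2 : bnd d p1 -> bnd d p2 -> bnd d (p1 + p2).
Proof.
move=> h1 h2 k /msuppD_le; rewrite mem_cat => /orP[/h1|/h2]; exact.
Qed.

Let bndN d p1 : bnd d p1 -> bnd d (- p1).
Proof. by move=> h k; rewrite (perm_mem (msuppN _)); apply: h. Qed.

Let bndC d c : bnd d c%:MP.
Proof.
by move=> k; rewrite msuppC; case: eqP => // _; rewrite inE => /eqP-> i; rewrite mnm0E.
Qed.

Let bndM d1 d2 p1 p2 : bnd d1 p1 -> bnd d2 p2 -> bnd (fun i => d1 i + d2 i)%N (p1 * p2).
Proof.
move=> h1 h2 k /msuppM_le /allpairsP[[k1 k2] /= [m1 m2 ->]] i.
by rewrite mnmDE leq_add ?h1 ?h2.
Qed.

Let bndW d1 d2 p : (forall i, d1 i <= d2 i)%N -> bnd d1 p -> bnd d2 p.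
Proof. by move=> le h k /h h' i; apply: leq_trans (h' i) (le i). Qed.

Let lagrange (a : 'rV[F]_m) : {mpoly F[m]} :=
  \prod_(i < m) (1 - ('X_i - (a 0 i)%:MP) ^+ #|F|.-1).

Let bnd_lin (i : 'I_m) c n :
  bnd (fun j => (j == i) * n)%N (('X_i - c%:MP) ^+ n).
Proof.
have h1 : bnd (fun j => (j == i)%N : nat) ('X_i - c%:MP).
  apply: bndD; last exact/bndN/bndC.
  by move=> k; rewrite msuppX inE => /eqP-> j; rewrite mnm1E eq_sym.
elim: n => [|n IH]; first by rewrite expr0; apply: bndC.
rewrite exprS; apply: bndW (bndM h1 IH) => j.
by rewrite mulnS.
Qed.

Let bnd_lagrange a : bnd (fun=> #|F|.-1) (lagrange a).
Proof.
have: bnd (fun j => \sum_(i < m) (j == i) * #|F|.-1)%N (lagrange a).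
  rewrite /lagrange; elim: (index_enum _) => [|i s IH].
    by rewrite big_nil; apply: bndC.
  rewrite big_cons; have h : bnd (fun j => (j == i) * #|F|.-1)%N
       (1 - ('X_i - (a 0 i)%:MP) ^+ #|F|.-1).
    by apply: bndD; [apply: bndC | apply/bndN/bnd_lin].
  by apply: bndW (bndM h IH) => j; rewrite big_cons.
apply: bndW => j; rewrite (bigD1 j) //= eqxx mul1n big1 ?addn0 // => i.
by rewrite eq_sym => /negPf->.
Qed.

Let lagrangeE a (x : 'rV[F]_m) : (lagrange a).@[fun i => x 0 i] = (x == a)%:R.
Proof.
rewrite /lagrange rmorph_prod /=.
have card1 : (0 < #|F|.-1)%N by rewrite -subn1 subn_gt0 finNzRing_gt1.
have -> : \prod_(i < m) (1 - ('X_i - (a 0 i)%:MP) ^+ #|F|.-1).@[fun i => x 0 i]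
        = \prod_(i < m) (x 0 i == a 0 i)%:R.
  apply: eq_bigr => i _; rewrite mevalB meval1 rmorphXn /= mevalB mevalXU mevalC.
  case: (eqVneq (x 0 i)) => [->|ne]; first by rewrite subrr expr0n -[_ == 0]negbK -lt0n card1 subr0.
  have nz : x 0 i - a 0 i != 0 by rewrite subr_eq0.
  suff -> : (x 0 i - a 0 i) ^+ #|F|.-1 = 1 by rewrite subrr.
  apply: (mulfI nz); rewrite -exprS prednK ?mulr1 ?expf_card //.
  exact: ltnW (finNzRing_gt1 _).
case: eqVneq => [->|ne]; first by rewrite big1 // => i _; rewrite eqxx.
have [i nei] : exists i, x 0 i != a 0 i.
  apply/existsP; apply: contra_neqT ne; rewrite negb_exists => /forallP h.
  by apply/rowP => i; apply/eqP; rewrite -[_ == _]negbK.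
by rewrite (bigD1 i) //= (negPf nei) mul0r.
Qed.

Lemma reduced_form_exists f : exists p, is_reduced_form f p.
Proof.
pose p : {mpoly F[m]} := \sum_a (f a)%:MP * lagrange a.
exists p; apply/andP; split.
  have h : bnd (fun=> #|F|.-1) p.
    rewrite /p; elim: (index_enum _) => [|a s IH].
      by rewrite big_nil; apply: bndC.
    rewrite big_cons; apply: bndD IH.
    apply: bndW (bndM (@bndC (fun=> 0%N) (f a)) (@bnd_lagrange a)) => i.
    by rewrite add0n.
  apply/allP => k /h hk; apply/forallP => i.
  by rewrite (leq_ltn_trans (hk i)) // prednK // ltnW // finNzRing_gt1.
apply/forallP => x; rewrite /p raddf_sum /= (bigD1 x) //= mevalM mevalC lagrangeE.
rewrite eqxx mulr1 big1 ?addr0 // => a ne.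
by rewrite mevalM lagrangeE eq_sym (negPf ne) mulr0.
Qed.

Let coef_poly (c : {ffun {ffun 'I_m -> 'I_#|F|} -> F}) : {mpoly F[m]} :=
  \sum_(a : {ffun 'I_m -> 'I_#|F|}) c a *: 'X_[[multinom (a i : nat) | i < m]].

Let poly_coef p : {ffun {ffun 'I_m -> 'I_#|F|} -> F} :=
  [ffun a : {ffun 'I_m -> 'I_#|F|} => p@_[multinom (a i : nat) | i < m]].

Let poly_coefK p : reduced p -> coef_poly (poly_coef p) = p.
Proof.
move=> /allP rp; apply/mpolyP => k; rewrite /coef_poly raddf_sum /=.
under eq_bigr => a _ do rewrite mcoeffZ mcoeffX ffunE.
case: (boolP [forall i, k i < #|F|]%N) => [/forallP lt|nlt].
  pose a0 : {ffun 'I_m -> 'I_#|F|} := [ffun i => Ordinal (lt i)].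
  have Ea0 : [multinom (a0 i : nat) | i < m] = k.
    by apply/mnmP => i; rewrite mnmE ffunE.
  rewrite (bigD1 a0) //= Ea0 eqxx mulr1 big1 ?addr0 // => a ne.
  case: eqP => [e|]; last by rewrite mulr0.
  case/eqP: ne; apply/ffunP => i; apply: val_inj.
  by rewrite ffunE /= -e mnmE.
rewrite memN_msupp_eq0; last by apply/negP => /rp h; rewrite h in nlt.
rewrite big1 // => a _; case: eqP => [e|]; last by rewrite mulr0.
by case/negP: nlt; apply/forallP => i; rewrite -e mnmE.
Qed.

Lemma reduced_form_unique f p1 p2 :
  is_reduced_form f p1 -> is_reduced_form f p2 -> p1 = p2.
Proof.
pose ev (c : {ffun {ffun 'I_m -> 'I_#|F|} -> F}) : rm_fun F m :=
  [ffun x : 'rV[F]_m => (coef_poly c).@[fun i => x 0 i]].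
have evE g p : is_reduced_form g p -> ev (poly_coef p) = g.
  case/andP=> rp /forallP h; apply/ffunP => x.
  by rewrite ffunE poly_coefK //; apply/eqP.
have inj : injective ev.
  suff /imset_injP h : #|ev @: setT| == #|[set: {ffun {ffun 'I_m -> 'I_#|F|} -> F}]|.
    by move=> c1 c2; apply: h; rewrite inE.
  have -> : ev @: setT = setT.
    apply/setP => g; rewrite inE; apply/imsetP.
    by have [p /evE <-] := reduced_form_exists g; exists (poly_coef p).
  by rewrite !cardsT !card_ffun card_mx mul1n !card_ord.
move=> h1 h2; have /andP[r1 _] := h1; have /andP[r2 _] := h2.
rewrite -(poly_coefK r1) -(poly_coefK r2); congr coef_poly.
by apply: inj; rewrite (evE _ _ h1) (evE _ _ h2).
Qed.

Definition reduced_form f : {mpoly F[m]} := xchoose (reduced_form_exists f).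

Lemma reduced_formP f : is_reduced_form f (reduced_form f).
Proof. exact: xchooseP. Qed.

(* [msize] is one more than the total degree of a nonzero polynomial; the zero
   function gets degree 0, so that it belongs to every code [RM r]. *)
Definition rm_deg f : nat := (msize (reduced_form f)).-1.

Definition RM (r : nat) : {set rm_fun F m} := [set f | (rm_deg f <= r)%N].

Definition fsupp f : {set 'rV[F]_m} := [set x | f x != 0].

Definition hweight f : nat := #|fsupp f|.

Definition is_affine_line (L : {set 'rV[F]_m}) :=
  exists a v : 'rV[F]_m, v != 0 /\ L = [set a + t *: v | t : F].

End Reduced.

(* Main.v *)
Require Import Defs.
From mathcomp Require Import all_boot all_order all_algebra all_field.
From mathcomp Require Import mpoly.
From mathcomp Require Import zify.

(** Codes of complementary degree are orthogonal: if [f] has degree at most [r]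
    and [g] degree at most [m (q - 1) - r - 1], then [f g] sums to zero. Hence,
    with [d = q - s - 2], no polynomial of degree at most [d] vanishes at all
    points of the support of [f] but one, while this support has [d + 3] points.
    If [x] is a point of the support and [{a, b}], [{c, e}] are disjoint pairs of
    other points of it, neither of them aligned with [x], then a product of two
    hyperplanes through these pairs and of [d - 2] hyperplanes through the
    remaining points is such a polynomial. The same holds for a single
    hyperplane if all points but one are aligned. Excluding these
    configurations forces the support to be aligned. *)

Section ReedMuller.
Set Implicit Arguments.
Unset Strict Implicit.
Unset Printing Implicit Defensive.
Import GRing.Theory.
Local Open Scope ring_scope.

(** For [k > 0], scaling by a nonzero [a] permutes [F] and multiplies the sum by [a ^+ k]; some
    [a ^+ k] differs from 1, as [X^k - 1] has at most [k] roots. *)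
Lemma sum_expf (F : finFieldType) k : (k < #|F|.-1)%N -> \sum_(t : F) t ^+ k = 0.
Proof.
case: k => [_|k lt_k].
  (* For [k = 0] every term is 1, and translation by 1 shows that these ones add up to zero. *)
  have: \sum_(t : F) (t + 1) = \sum_(t : F) t.
    by rewrite [RHS](reindex_inj (addIr 1)).
  rewrite big_split /= => /eqP; rewrite -subr_eq0 addrAC subrr add0r => /eqP sum1.
  by under eq_bigr do rewrite expr0.
have [a nz_a ak] : exists2 a : F, a != 0 & a ^+ k.+1 != 1.
  apply/exists_inP; apply: contraTT lt_k => /exists_inPn roots1.
  pose p : {poly F} := 'X^(k.+1) - 1.
  have sz_p : size p = k.+2 by rewrite size_XnsubC.
  rewrite -leqNgt -ltnS -sz_p -(cardC1 (0 : F)) cardE.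
  apply: max_poly_roots; rewrite ?enum_uniq -?size_poly_gt0 ?sz_p //.
  apply/allP => a; rewrite mem_enum => /roots1 /negPn /eqP ak.
  by rewrite rootE hornerD hornerN hornerC hornerXn ak subrr.
have /eqP : \sum_(t : F) t ^+ k.+1 = a ^+ k.+1 * \sum_(t : F) t ^+ k.+1.
  rewrite [LHS](reindex_inj (mulfI nz_a)) mulr_sumr.
  by apply: eq_bigr => t _; rewrite exprMn.
rewrite -subr_eq0 -{1}[\sum_t _]mul1r -mulrBl mulf_eq0 subr_eq0 eq_sym.
by rewrite (negPf ak) => /eqP.
Qed.

Section AffineSpace.
Variables (F : finFieldType) (m : nat).
Implicit Types (p g : {mpoly F[m]}) (f : rm_fun F m).
Implicit Types (a b c e x y : 'rV[F]_m) (T : {set 'rV[F]_m}) (d : nat).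

Local Notation eval p x := p.@[fun i => x 0 i].

(** The sum of a monomial factors into one power sum per coordinate. Degree below [m (q - 1)] forces
    some exponent below [q - 1], whose factor vanishes. *)
Lemma sum_meval p :
  (msize p <= m * #|F|.-1)%N -> \sum_(x : 'rV[F]_m) eval p x = 0.
Proof.
move=> deg_p; under eq_bigr do rewrite mevalE.
rewrite exchange_big big_seq big1 //= => k /msize_mdeg_lt lt_k.
have [i lt_i] : exists i, (k i < #|F|.-1)%N.
  apply/existsP; apply: contraTT (leq_trans lt_k deg_p).
  rewrite negb_exists => /forallP ge_k; rewrite -leqNgt mdegE.
  rewrite -[m in (m * _)%N]card_ord -sum_nat_const.
  by apply: leq_sum => i _; rewrite leqNgt ge_k.
rewrite -mulr_sumr.
suff -> : \sum_(x : 'rV[F]_m) \prod_j x 0 j ^+ k j = 0 by rewrite mulr0.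
rewrite (reindex (fun h : {ffun 'I_m -> F} => \row_j h j)) /=; last first.
  exists (fun x => [ffun j => x 0 j]) => x _.
    by apply/ffunP => j; rewrite ffunE mxE.
  by apply/rowP => j; rewrite mxE ffunE.
transitivity (\sum_(h : {ffun 'I_m -> F}) \prod_j h j ^+ k j).
  by apply: eq_bigr => h _; apply: eq_bigr => j _; rewrite mxE.
rewrite -(bigA_distr_bigA (fun j (t : F) => t ^+ k j)).
by apply/eqP; rewrite prodf_seq_eq0; apply/hasP; exists i; rewrite ?mem_index_enum ?sum_expf //=.
Qed.

Lemma RM_orthogonal f g r : f \in RM F m r ->
  (r + msize g <= m * #|F|.-1)%N -> \sum_x f x * eval g x = 0.
Proof.
rewrite inE /rm_deg; have /andP[_ /forallP/(_ _)/eqP eval_f] := reduced_formP f.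
move: (reduced_form f) eval_f => p eval_f deg_p deg_g.
under eq_bigr do rewrite -eval_f -mevalM.
have [->|nz_p] := eqVneq p 0; first by rewrite mul0r big1 // => x _; rewrite meval0.
have [->|nz_g] := eqVneq g 0; first by rewrite mulr0 big1 // => x _; rewrite meval0.
apply: sum_meval; rewrite msizeM // (leq_trans _ deg_g) //.
by rewrite (mpolySpred mdeg nz_p) addSn /= leq_add2r.
Qed.

(** As [msize] exceeds the degree by one, [g] has degree at most [d]. *)
Definition separated d T x := exists g,
  [/\ (msize g <= d.+1)%N, {in T, forall y, eval g y = 0} & eval g x != 0].

Lemma separatedW d1 d2 T1 T2 x :
  (d1 <= d2)%N -> T2 \subset T1 -> separated d1 T1 x -> separated d2 T2 x.
Proof.
move=> le_d sT [g [deg_g g0 gx]]; exists g; split=> //.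
  exact: leq_trans deg_g _.
by move=> y /(subsetP sT); apply: g0.
Qed.

Lemma separatedU d1 d2 T1 T2 x :
  separated d1 T1 x -> separated d2 T2 x -> separated (d1 + d2) (T1 :|: T2) x.
Proof.
move=> [g1 [deg1 g10 g1x]] [g2 [deg2 g20 g2x]]; exists (g1 * g2); split.
- have nz g : eval g x != 0 -> g != 0 by apply: contraNneq => ->; rewrite meval0.
  by rewrite msizeM ?nz // -subn1 leq_subLR (leq_trans (leq_add deg1 deg2)) // addSn addnS.
- by move=> y /setUP[/g10|/g20] gy; rewrite mevalM gy ?mul0r ?mulr0.
by rewrite mevalM mulf_neq0.
Qed.

(** For [a = b] this is a single point, a case used in [separated_set]. *)
Definition line a b : {set 'rV[F]_m} := [set a + t *: (b - a) | t : F].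

Lemma mem_line_l a b : a \in line a b.
Proof. by apply/imsetP; exists 0; rewrite // scale0r addr0. Qed.

Lemma mem_line_r a b : b \in line a b.
Proof. by apply/imsetP; exists 1; rewrite // scale1r addrC subrK. Qed.

(** A column of the cokernel of [b - a] is a linear form that kills [b - a]; one of them is nonzero
    at [x - a], and [g] is its translate to [a]. *)
Lemma separated_line a b x : x \notin line a b -> separated 1 (line a b) x.
Proof.
move=> x_off.
have : ~~ (x - a <= b - a)%MS.
  apply: contra x_off => /sub_rVP[t xat]; apply/imsetP; exists t => //.
  by rewrite -xat addrC subrK.
rewrite submxE => /eqP/rowP/eqfunP; rewrite negb_forall => /existsP[j].
set c := cokermx _; rewrite !mxE => nz_j.
pose g : {mpoly F[m]} := \sum_i c i j *: ('X_i - (a 0 i)%:MP).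
have eval_g y : eval g y = ((y - a) *m c) 0 j.
  rewrite raddf_sum mxE /=; apply: eq_bigr => i _.
  by rewrite mevalZ mevalB mevalXU mevalC !mxE mulrC.
exists g; split; last by rewrite eval_g mxE.
  apply: leq_trans (msize_sum _ _ _) _; apply/bigmax_leqP => i _.
  apply: leq_trans (msizeZ_le _ _) _; apply: leq_trans (msizeD_le _ _) _.
  by rewrite msizeN msizeX mdeg1 msizeC; case: (_ != _).
move=> y /imsetP[t _ ->]; rewrite eval_g addrC addKr.
by rewrite -scalemxAl mulmx_coker scaler0 mxE.
Qed.

Lemma separated_set T x : x \notin T -> separated #|T| T x.
Proof.
move: {2}#|T| (erefl #|T|) => n; elim: n T => [|n IH] T card_T x_off.
  exists 1; split; rewrite ?msize1 ?meval1 ?oner_neq0 //.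
  by move=> y; rewrite (cards0_eq card_T) inE.
have /card_gt0P[y Ty] : (0 < #|T|)%N by rewrite card_T.
have card_T' : #|T :\ y| = n.
  by move: card_T; rewrite (cardsD1 y) Ty => -[].
have -> : #|T| = (1 + #|T :\ y|)%N by rewrite card_T card_T'.
rewrite -[T in separated _ T _](setD1K Ty).
apply: separatedU; last by apply: IH; rewrite // !inE negb_and x_off orbT.
apply: separatedW (leqnn 1) _ (separated_line (a := y) (b := y) _).
  by rewrite sub1set mem_line_l.
apply: contra x_off => /imsetP[t _ ->].
by rewrite subrr scaler0 addr0.
Qed.

(* [{a, b}] and [{c, e}] are covered by one hyperplane each, so that two
   degrees are saved over [separated_set]. *)
Lemma separated_pairs T x a b c e : x \notin T -> uniq [:: a; b; c; e] ->
  {subset [:: a; b; c; e] <= T} -> x \notin line a b -> x \notin line c e ->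
  separated (#|T| - 2) T x.
Proof.
move=> x_off uniq4 sub4 x_ab x_ce.
pose Q := [set y in [:: a; b; c; e]].
have sQT : Q \subset T by apply/subsetP => y; rewrite inE; apply: sub4.
have card_Q : #|Q| = 4 by rewrite cardsE; apply/card_uniqP.
have card_T : (#|T| - 2 = 1 + 1 + #|T :\: Q|)%N.
  by rewrite cardsD (setIidPr sQT) card_Q -(subnKC (subset_leq_card sQT)) card_Q addKn.
rewrite card_T -[T in separated _ T _](setID T Q) (setIidPr sQT).
apply: separatedU; last first.
  by apply: separated_set; rewrite inE negb_and x_off orbT.
apply: separatedW (leqnn _) _ (separatedU (separated_line x_ab) (separated_line x_ce)).
apply/subsetP => y; rewrite !inE => /or4P[] /eqP->.
all: by rewrite ?mem_line_l ?mem_line_r ?orbT.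
Qed.

Lemma lineC a b : line a b = line b a.
Proof.
suff sub a' b' : line a' b' \subset line b' a'.
  by apply/eqP; rewrite eqEsubset !sub.
apply/subsetP => _ /imsetP[t _ ->]; apply/imsetP; exists (1 - t) => //.
by rewrite scalerBl scale1r -(opprB b' a') scalerN opprK addrA opprB addrCA subrr addr0.
Qed.

Lemma line_sym a b x : a != x -> a \in line x b -> b \in line x a.
Proof.
move=> ne_ax /imsetP[t _ def_a]; apply/imsetP; exists t^-1 => //.
have nz_t : t != 0 by apply: contraNneq ne_ax => t0; rewrite def_a t0 scale0r addr0.
by rewrite def_a addrAC subrr add0r scalerA mulVf // scale1r addrC subrK.
Qed.

Lemma line_switch a c e x : x != a -> x \in line c e -> a \in line c e -> c \in line x a.
Proof.
move=> ne_xa /imsetP[t _ def_x] /imsetP[u _ def_a].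
have nz_tu : t - u != 0.
  by rewrite subr_eq0; apply: contraNneq ne_xa => tu; rewrite def_x def_a tu.
(* Since [x - c = t (e - c)] and [a - x = (u - t) (e - c)], this is the parameter of [c] on
   [line x a]. *)
apply/imsetP; exists (t / (t - u)) => //.
rewrite def_x def_a opprD addrACA subrr add0r -scalerBl scalerA.
by rewrite -(opprB t u) mulrN divfK // scaleNr addrK.
Qed.

Lemma line_of_unseparated d T : (2 <= d)%N -> #|T| = d.+3 ->
  {in T, forall x, ~ separated d (T :\ x) x} ->
  exists x a, x != a /\ T \subset line x a.
Proof.
move=> d_ge2 card_T unsep.
have card_D x : x \in T -> #|T :\ x| = d.+2.
  by move=> Tx; move: card_T; rewrite (cardsD1 x) Tx => -[].
have other (s : seq 'rV[F]_m) : (size s < #|T|)%N -> exists2 y, y \in T & y \notin s.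
  move=> lt_s; apply/exists_inP; apply: contraTT lt_s => /exists_inPn T_s.
  rewrite -leqNgt; apply: leq_trans (card_size s); apply: subset_leq_card.
  by apply/subsetP => y /T_s /negPn.
have [x Tx _] : exists2 y, y \in T & y \notin [::] by apply: other; rewrite card_T.
have [a Ta] : exists2 y, y \in T & y \notin [:: x] by apply: other; rewrite card_T.
rewrite inE => ne_ax; exists x, a; split; first by rewrite eq_sym.
apply/subsetP => b Tb; apply: contraT => b_off.
(* Otherwise a hyperplane through [line x a] separates [b] from all other points in degree 1. *)
have [c Tc /andP[ne_cb c_off]] : exists2 c, c \in T & (c != b) && (c \notin line x a).
  apply/exists_inP; apply: contraT => /exists_inPn on_line.
  case: (unsep b Tb); apply: separatedW _ _ (separated_line b_off).
    exact: ltnW.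
  apply/subsetP => y /setD1P[ne_yb /on_line].
  by rewrite ne_yb negbK.
(* A fifth point exists because [d + 3 >= 5]. *)
have [e Te] : exists2 y, y \in T & y \notin [:: x; a; b; c].
  by apply: other; rewrite card_T !ltnS.
rewrite !inE !negb_or => /and4P[ne_ex ne_ea ne_eb ne_ec].
have off_ne y : y \notin line x a -> (y != x) /\ (y != a).
  by move=> y_off; split; apply: contraNneq y_off => ->; rewrite ?mem_line_l ?mem_line_r.
have [ne_bx ne_ba] := off_ne b b_off; have [ne_cx ne_ca] := off_ne c c_off.
(* By [separated_pairs] with [{w, b}] and [{c, e}], [z] must lie on one of the two lines. Applied to
   both [x] and [a], this puts them on [line c e], hence [c] on [line x a]. *)
have aligned z w : z \in T -> w \in T -> uniq [:: z; w; b; c; e] ->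
    z \notin line w b -> z \in line c e.
  move=> Tz Tw /andP[z_notin uniq4] z_off; apply: contraT => z_off'.
  case: (unsep z Tz); have -> : d = (#|T :\ z| - 2)%N by rewrite card_D // subn2.
  apply: separated_pairs uniq4 _ z_off z_off'; first by rewrite setD11.
  move=> y y_in; rewrite !inE (memPn z_notin) //.
  by move: y_in; rewrite !inE => /or4P[] /eqP->.
have uniq_xa : uniq [:: x; a; b; c; e].
  by rewrite -rev_uniq /rev /= !inE !negb_or ne_ec ne_eb ne_ea ne_ex ne_cb ne_ca ne_cx ne_ba ne_bx ne_ax.
have uniq_ax : uniq [:: a; x; b; c; e].
  by rewrite (perm_uniq (s2 := [:: x; a; b; c; e])) // (perm_catCA [:: a] [:: x] [:: b; c; e]).
have x_ce : x \in line c e.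
  apply: (aligned x a) => //; apply: contra b_off => x_ab.
  by rewrite lineC line_sym // eq_sym.
have a_ce : a \in line c e.
  by apply: (aligned a x) => //; apply: contra b_off; apply: line_sym.
by rewrite (line_switch _ x_ce a_ce) 1?eq_sym in c_off.
Qed.

End AffineSpace.
End ReedMuller.

Theorem theorem2p1 (F : finFieldType) (q m s : nat) (f : rm_fun F m)
    (cardF : #|F| = q)
    (m_ge2 : (2 <= m)%N) (q_ge5 : (5 <= q)%N)
    (s_bounds : (1 <= s <= q - 4)%N)
    (f_RM : f \in RM F m ((m - 1) * (q - 1) + s)%N)
    (wt_f : hweight f = (q - s + 1)%N) :
  exists L : {set 'rV[F]_m}, is_affine_line L /\ fsupp f \subset L.
Proof.
have d_ge2 : 2 <= q - s - 2 by lia.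
have card_f : #|fsupp f| = (q - s - 2).+3 by rewrite -/(hweight f) wt_f; lia.
have [|x [a [ne_xa sub_f]]] := @line_of_unseparated F m _ _ d_ge2 card_f.
  move=> x supp_x [g [deg_g g0 gx]].
  (* The choice [d = q - s - 2] gives equality here when [msize g = d + 1]. *)
  have deg_fg : (m - 1) * (q - 1) + s + msize g <= m * #|F|.-1.
    rewrite cardF; move: (msize g) deg_g => k deg_g; nia.
  (* Only the term at [x] survives in the sum, and it is nonzero. *)
  have := RM_orthogonal f_RM deg_fg; rewrite (bigD1 x) //= big1 ?GRing.addr0 => [/eqP|y ne_yx].
    by rewrite GRing.mulf_eq0 (negPf gx) orbF; move: supp_x; rewrite inE => /negPf->.
  have [->|nz_fy] := eqVneq (f y) 0%R; first by rewrite GRing.mul0r.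
  by rewrite g0 ?GRing.mulr0 // !inE ne_yx.
exists (line x a); split=> //; exists x, (a - x)%R; split=> //.
by rewrite GRing.subr_eq0 eq_sym.
Qed.
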